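(* For every integer $s \geq 1$, the number $2-1/s$ is star realisable; that is, there is a graph $H$ with $\mathrm{ar}^{\star}(n,H) = \Theta(n^{2-1/s})$ as $n\to\infty$.
   Context: A star-colouring of a graph $G$ is an edge-colouring of $G$ in which every colour class is a star (a copy of $K_{1,m}$ with $m\ge 1$, a single edge being allowed). An edge-coloured graph is rainbow if all its edges have different colours. For a graph $H$, $\mathrm{ar}^{\star}(n,H)$ denotes the maximum number of colours in a star-colouring of $K_n$ without a rainbow copy of $H$. A real number $r\in[1,2]$ is star realisable if there is a (fixed) graph $H$ with $\mathrm{ar}^{\star}(n,H)=\Theta(n^r)$. *)

(* Defs.v *)
From HB Require Import structures.
From mathcomp Require Import all_boot all_order all_algebra.
From mathcomp Require Import all_classical all_reals all_analysis.

Set Implicit Arguments.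
Unset Strict Implicit.
Unset Printing Implicit Defensive.

Import Order.TTheory GRing.Theory Num.Theory.
Import numFieldNormedType.Exports.

Local Open Scope ring_scope.

Record sgraph := SGraph {
  vertex :> finType;
  adj : rel vertex;
  adj_sym : symmetric adj;
  adj_irrefl : irreflexive adj }.

Definition edges (G : sgraph) : {set {set G}} :=
  [set e | [exists x, exists y, adj x y && (e == [set x; y])]].

Definition complete_adj (n : nat) : rel 'I_n := fun x y => x != y.

Lemma complete_adj_sym n : symmetric (@complete_adj n).
Proof. by move=> x y; rewrite /complete_adj eq_sym. Qed.

Lemma complete_adj_irrefl n : irreflexive (@complete_adj n).
Proof. by move=> x; rewrite /complete_adj eqxx. Qed.

Definition complete_graph (n : nat) : sgraph :=
  SGraph (@complete_adj_sym n) (@complete_adj_irrefl n).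

(* [E] is the edge set of a copy of K_{1,m}, m >= 1, with centre [v] and set of
   leaves [L]. *)
Definition is_star (V : finType) (E : {set {set V}}) : bool :=
  [exists v : V, exists L : {set V},
     [&& v \notin L, L != finset.set0 & E == [set [set v; x] | x in L]]].

(* An edge-colouring is a function on all vertex sets of which only the values
   on edges are ever used. *)
Section EdgeColouring.
Variables (G : sgraph) (C : finType) (c : {set G} -> C).

Definition colours : {set C} := c @: edges G.

Definition colour_class (i : C) : {set {set G}} := [set e in edges G | c e == i].

Definition star_colouring : bool :=
  [forall (i | i \in colours), is_star (colour_class i)].

(* Copies are subgraphs, not necessarily induced. *)
Definition is_copy (H : sgraph) (f : {ffun H -> G}) : bool :=
  injectiveb f && [forall x, forall y, adj x y ==> adj (f x) (f y)].

Definition rainbow_copy (H : sgraph) (f : {ffun H -> G}) : bool :=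
  is_copy f &&
  [forall e in edges H, forall e' in edges H,
     (c (f @: e) == c (f @: e')) ==> (e == e')].

Definition has_rainbow (H : sgraph) : bool :=
  [exists f : {ffun H -> G}, rainbow_copy f].

End EdgeColouring.

(* Colours are drawn from the vertex sets of K_n, of which there are at least as
   many as edges; [leq_ar_star] shows that other palettes give nothing more.
   The value is 0 if no such colouring exists. *)
Definition ar_star (n : nat) (H : sgraph) : nat :=
  \max_(c : {ffun {set complete_graph n} -> {set complete_graph n}}
        | star_colouring c && ~~ has_rainbow c H) #|colours c|.

Lemma leq_ar_star (n : nat) (H : sgraph) (C : finType)
    (c : {set complete_graph n} -> C) :
  star_colouring c -> ~~ has_rainbow c H -> (#|colours c| <= ar_star n H)%N.
Proof.
move=> sc rc; pose G := complete_graph n.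
pose g (i : C) : {set G} := odflt finset.set0 [pick e in edges G | c e == i].
have gK e : e \in edges G -> c (g (c e)) = c e.
  move=> eE; rewrite /g; case: pickP => [e' /andP[_ /eqP]//|/(_ e)].
  by rewrite eE eqxx.
pose d : {ffun {set G} -> {set G}} := [ffun e => g (c e)].
have dE e e' : e \in edges G -> e' \in edges G -> (d e == d e') = (c e == c e').
  move=> eE e'E; rewrite !ffunE; apply/eqP/eqP => [h|->//].
  by rewrite -(gK e) // h gK.
have colE : colours d = g @: colours c.
  by rewrite /colours -imset_comp; apply: eq_imset => e; rewrite ffunE.
have -> : #|colours c| = #|colours d|.
  rewrite colE card_in_imset// => _ _ /imsetP[e eE ->] /imsetP[e' e'E ->] h.
  by rewrite -(gK e) // h gK.
apply: (@leq_bigmax_cond _ _ (fun d => #|colours (fun_of_fin d)|) d).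
apply/andP; split.
  apply/forall_inP => _ /imsetP[e eE ->].
  move/forall_inP: sc => /(_ (c e) (imset_f _ eE)).
  congr is_star; apply/setP => e'.
  rewrite [LHS]finset.in_set [RHS]finset.in_set.
  by case e'E: (e' \in edges G) => //=; rewrite dE.
apply: contra rc => /existsP[f /andP[fc /forall_inP fr]].
apply/existsP; exists f; rewrite /rainbow_copy fc /=.
have fE e : e \in edges H -> f @: e \in edges G.
  rewrite !inE => /existsP[x /existsP[y /andP[xy /eqP->]]].
  case/andP: fc => _ /forallP/(_ x)/forallP/(_ y)/implyP/(_ xy) fxy.
  by apply/existsP; exists (f x); apply/existsP; exists (f y);
    rewrite fxy imsetU1 imset_set1 eqxx.
apply/forall_inP => e eE; apply/forall_inP => e' e'E.
by rewrite -dE ?fE//; move/forall_inP: (fr e eE); apply.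
Qed.

Local Open Scope classical_set_scope.

Definition star_realisable (R : realType) (r : R) : Prop :=
  1 <= r <= 2 /\
  exists H : sgraph,
    (fun n : nat => (ar_star n H)%:R : R) \is 'Theta_\oo (fun n : nat => n%:R `^ r).

(* Main.v *)
(* For s >= 2 take H = K_{s+1,t} with t large.

   Upper bound: fix a centre of every colour and let R u contain one leaf of each
   star centred at u.  For an s-set S, the vertices u with S <= R u together with S
   span a rainbow K_{s,|T|}.  If T contains a vertex v and more than t vertices u
   such that uv is centred at u with a colour different from those of the edges
   from u to S, then S + v extends it to a rainbow K_{s+1,t+1}.  For each pair
   u, v at most one element of R u must be kept out of S, so double counting shows
   that the sum of 'C(|R u|, s) is O(n^s), hence that of |R u| is O(n^(2-1/s)).

   Lower bound: colour the edges of a K_{s,N+1}-free graph F with distinct colours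
   and every other edge by its smaller end.  A rainbow K_{s+1,t} uses each vertex
   as such a colour at most once, hence contains a K_{s,N+1} of F.  For F take the
   norm graph: x ~ y iff N(x + y) = 1 in GF(q^s), with q a power of 2.

   For s = 1 take H = K_3: two stars centred at the same vertex give a rainbow
   triangle. *)

Require Import Defs.
From mathcomp Require Import all_boot all_order all_algebra all_field.
From mathcomp Require Import all_classical all_reals all_analysis.
From mathcomp Require Import zify ring lra.

Set Implicit Arguments.
Unset Strict Implicit.
Unset Printing Implicit Defensive.

Import Order.TTheory GRing.Theory Num.Theory.

Local Open Scope ring_scope.

(** * Systems of product equations and the norm graph *)

Section ProductSystem.
Variables (F : fieldType) (m : nat).
Variable al : 'I_m.+1 -> 'I_m -> F.
Hypothesis al_inj : forall j, injective (al ^~ j).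

(** Up to a scalar, [lag i j] is the Lagrange basis polynomial of the node [al i j] among the nodes
    of coordinate [j]; [lag2 i k j] also omits the factor of the node [al k j]. *)
Let lag (i : 'I_m.+1) (j : 'I_m) (t : F) : F := \prod_(k | k != i) (t - al k j).
Let lag2 (i k : 'I_m.+1) (j : 'I_m) (t : F) : F :=
  \prod_(l | (l != i) && (l != k)) (t - al l j).

Lemma lag_factor i k j t : i != k -> lag i j t = (t - al k j) * lag2 i k j t.
Proof. by move=> ik; rewrite /lag (bigD1 k) //= eq_sym. Qed.

(** The polynomials [lag k j] and [lag i j] are [lag2 i k j] times [t - al i j] and [t - al k j],
    and the difference of these two factors does not depend on [t]. *)
Lemma lag2_decomp i k j t : i != k ->
  lag2 i k j t = (lag k j t - lag i j t) / (al k j - al i j).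
Proof.
move=> ik; have ki : k != i by rewrite eq_sym.
rewrite (lag_factor _ _ ik) (lag_factor _ _ ki).
have -> : lag2 k i j t = lag2 i k j t by apply: eq_bigl => l; rewrite andbC.
have nz : al k j - al i j != 0 by rewrite subr_eq0 (inj_eq (@al_inj j)).
by field.
Qed.

Let I := {ffun 'I_m -> 'I_m.+1}.
Let E (f : I) (x : 'I_m -> F) : F := \prod_j lag (f j) j (x j).

Lemma missed_value (f : I) : exists k, [forall j, f j != k].
Proof.
have : (#|codom f| < #|'I_m.+1|)%N.
  by rewrite (leq_ltn_trans (leq_image_card _ _)) // !card_ord.
rewrite ltnNge => /negP H.
have [k kP] : exists k, k \notin codom f.
  apply/existsP; apply: contraT; rewrite negb_exists => /forallP H'.
  case: H; apply/subset_leq_card/fintype.subsetP => k _.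
  by move: (H' k); rewrite negbK.
by exists k; apply/forallP => j; apply: contra kP => /eqP <-; exact: codom_f.
Qed.

(** In each coordinate the Lagrange polynomials have no common zero: at a node its own polynomial
    survives, elsewhere all do. This makes the eigenvector below nonzero. *)
Lemma lagrange_nonzero (x : 'I_m -> F) : exists f : I, E f x != 0.
Proof.
have H j : exists i, lag i j (x j) != 0.
  case: (pickP (fun i => x j == al i j)) => [i /eqP xi|H]; last first.
    by exists ord0; apply/prodf_neq0 => k _; rewrite subr_eq0 H.
  exists i; apply/prodf_neq0 => k ki.
  by rewrite subr_eq0 xi (inj_eq (@al_inj j)) eq_sym.
exists [ffun j => xchoose (H j)].
by apply/prodf_neq0 => j _; rewrite ffunE (xchooseP (H j)).
Qed.

(* The products [E f] of Lagrange polynomials span the polynomials of degree at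
   most [m] in each variable.  As [f] misses some value [k], the [k]-th left-hand
   product divides [E f], so the [k]-th equation expresses [(y - a k) * E f x]
   as a linear combination of the [E g x]: the vector [(E f x)_f] is an
   eigenvector, with eigenvalue essentially [y], of a matrix independent of the
   solution [(y, x)]. *)
Lemma product_system_root (a b : 'I_m.+1 -> F) :
  exists p : {poly F}, [/\ p != 0, (size p <= (m.+1 ^ m).+1)%N &
    forall y (x : 'I_m -> F),
      (forall i, (y - a i) * \prod_j (x j - al i j) = b i) -> root p y].
Proof.
have cI : #|{: I}| = (m.+1 ^ m)%N by rewrite card_ffun !card_ord.
pose miss (f : I) : 'I_m.+1 := xchoose (missed_value f).
have missP (f : I) j : f j != miss f by move/forallP: (xchooseP (missed_value f)); apply.
(* The coefficients of [lag2 (f j) (miss f) j] in the Lagrange basis, read off from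
   [lag2_decomp]. *)
pose co (f : I) (j : 'I_m) (l : 'I_m.+1) : F :=
  ((l == miss f)%:R - (l == f j)%:R) / (al (miss f) j - al (f j) j).
pose g : 'M[F]_#|{: I}| := \matrix_(u, v)
  let h : I := enum_val u in let f : I := enum_val v in
  b (miss f) * \prod_j co f j (h j) + (u == v)%:R * a (miss f).
exists (char_poly g); split; first by rewrite monic_neq0 // char_poly_monic.
  by rewrite size_char_poly cI.
move=> y x sys; rewrite -eigenvalue_root_char; apply/eigenvalueP.
exists (\row_u E (enum_val u : I) x); last first.
  have [f fn0] := lagrange_nonzero x.
  apply: contra fn0 => /eqP/rowP/(_ (enum_rank f)).
  by rewrite !mxE enum_rankK => ->.
apply/rowP => v; rewrite !mxE; set f : I := enum_val v.
have -> : y * E f x = (y - a (miss f)) * E f x + a (miss f) * E f x by ring.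
have -> : (y - a (miss f)) * E f x = b (miss f) * \prod_j lag2 (f j) (miss f) j (x j).
  rewrite -sys -mulrA -big_split /=; congr (_ * _); apply: eq_bigr => j _.
  exact: lag_factor.
have -> : \prod_j lag2 (f j) (miss f) j (x j) =
    \prod_j \sum_l co f j l * lag l j (x j).
  apply: eq_bigr => j _; rewrite lag2_decomp //.
  have pick_term i c : \sum_l (l == i)%:R * lag l j (x j) / c = lag i j (x j) / c.
    rewrite (bigD1 i) //= eqxx big1 ?mul1r ?addr0 // => l /negbTE ->.
    by rewrite !mul0r.
  rewrite mulrBl -!pick_term -sumrB; apply: eq_bigr => l _.
  by rewrite /co; ring.
rewrite bigA_distr_bigA /=.
transitivity (\sum_(u : 'I_#|{: I}|) (b (miss f) *
      ((\prod_j co f j ((enum_val u : I) j)) * E (enum_val u : I) x) +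
    (u == v)%:R * a (miss f) * E (enum_val u : I) x)).
  by apply: eq_bigr => u _; rewrite !mxE -/f /=; ring.
rewrite big_split /=; congr (_ + _).
  rewrite -mulr_sumr; congr (_ * _).
  rewrite [RHS](reindex (fun u : 'I_#|{: I}| => enum_val u : I)) /=; last first.
    by apply: onW_bij; exact: enum_val_bij.
  by apply: eq_bigr => u _; rewrite [RHS]big_split.
rewrite (bigD1 v) //= eqxx mul1r big1 ?addr0 // => u /negbTE ->.
by rewrite !mul0r.
Qed.

End ProductSystem.

(** * Norm graphs in characteristic 2: degrees and codegrees *)

Section NormGraph.
Variables (L : finFieldType) (q m : nat).
Hypotheses (q_gt0 : (0 < q)%N) (pchar2 : 2%N \in [pchar L])
  (q2 : (2%N : nat_pred).-nat q) (cardL : #|L| = (q ^ m.+1)%N).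

Let nrm (z : L) : L := z ^+ (\sum_(j < m.+1) q ^ j)%N.

Definition norm_adj : rel L := fun x y => nrm (x + y) == 1.

Lemma norm_adj_sym : symmetric norm_adj.
Proof. by move=> x y; rewrite /norm_adj addrC. Qed.

Lemma norm_adj_irrefl : irreflexive norm_adj.
Proof.
move=> x; rewrite /norm_adj addrr_pchar2 // /nrm big_ord_recl expn0.
by rewrite exprS mul0r eq_sym oner_eq0.
Qed.

(** Since nonzero [z] satisfy [z ^+ (q ^ m.+1).-1 = 1], the map [h] sending [z] to [z ^+ q.-1] takes
    them to elements of norm one. Its fibres have at most [q.-1] elements, so its image has at least
    [M] elements, where [M] is the norm exponent. *)
Lemma card_norm_one : (q ^ m <= #|[set z | nrm z == 1%R]|)%N.
Proof.
have q1 : (1 < q)%N.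
  rewrite ltn_neqAle q_gt0 andbT; apply/eqP => q1.
  by have := finNzRing_gt1 L; rewrite cardL -q1 exp1n.
set M := (\sum_(j < m.+1) q ^ j)%N.
have qM : (q ^ m <= M)%N by rewrite /M big_ord_recr leq_addl.
apply: (leq_trans qM).
have E1 : (q ^ m.+1).-1 = (q.-1 * M)%N := predn_exp q m.+1.
pose A := [set z : L | z != 0].
have cA : #|A| = (q.-1 * M)%N.
  rewrite -E1 -cardL -(cardC1 (0 : L)); apply: eq_card => z.
  by rewrite !inE.
pose h (z : L) := z ^+ q.-1.
have sub : h @: A \subset [set z | nrm z == 1%R].
  apply/fintype.subsetP => _ /imsetP[z zA ->]; move: zA; rewrite !finset.inE => z0.
  rewrite /nrm /h -exprM -E1 -cardL -(inj_eq (mulfI z0)) -exprS mulr1.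
  by rewrite prednK ?expf_card // cardL expn_gt0 q_gt0.
apply: leq_trans (subset_leq_card sub).
have : (#|A| <= #|h @: A| * q.-1)%N.
  rewrite -sum1_card (partition_big h (mem (h @: A))) /=; last first.
    by move=> z zA; exact: imset_f.
  rewrite -sum_nat_const; apply: leq_sum => w _; rewrite sum1_card.
  have p0 : 'X^(q.-1) - w%:P != 0 :> {poly L}.
    by rewrite -size_poly_gt0 size_XnsubC // -ltnS prednK.
  have := @max_poly_roots _ _ (enum [pred z | (z \in A) && (h z == w)]) p0.
  rewrite enum_uniq size_XnsubC; last by rewrite -ltnS prednK.
  rewrite ltnS -cardE; apply => //.
  apply/allP => z; rewrite mem_enum !inE => /andP[_ /eqP <-].
  by rewrite /root !hornerE subrr.
by rewrite cA mulnC leq_pmul2r // -ltnS prednK.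
Qed.

Lemma norm_degree (x : L) : (q ^ m <= #|[set y | norm_adj x y]|)%N.
Proof.
apply: leq_trans card_norm_one _.
rewrite -(card_imset [set z | nrm z == 1%R] (addrI (- x))); apply/subset_leq_card/fintype.subsetP.
by move=> _ /imsetP[z zP ->]; rewrite !finset.inE /norm_adj addrA subrr add0r in zP *.
Qed.

(** Frobenius powers are additive, so the norm of [a i + x] is the product over [j <= m] of
    [a i ^+ (q ^ j) + x ^+ (q ^ j)]. Reading the powers of [x] as separate unknowns gives a product
    system with [y = x]; hence all common neighbours are roots of one polynomial of degree at most
    [m.+1 ^ m]. *)
Lemma norm_codegree (a : 'I_m.+1 -> L) : injective a ->
  (#|[set x | [forall i, norm_adj (a i) x]]| <= m.+1 ^ m)%N.
Proof.
move=> a_inj.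
(* Signs are immaterial in characteristic 2; the difference fits the factors in
   [product_system_root]. *)
have frobE k (x y : L) : (x + y) ^+ (q ^ k) = x ^+ (q ^ k) - y ^+ (q ^ k).
  rewrite exprDn_pchar ?oppr_pchar2 // (eq_pnat _ (pcharf_eq pchar2)).
  by rewrite pnatX q2.
have frob_inj k : injective (fun x : L => x ^+ (q ^ k)).
  move=> x y /= xy; apply/eqP; rewrite -subr_eq0 -(oppr_pchar2 pchar2 y) opprK.
  have := frobE k x y; rewrite xy subrr => /eqP.
  by rewrite expf_eq0 => /andP[].
pose al (i : 'I_m.+1) (j : 'I_m) : L := a i ^+ (q ^ j.+1).
have al_inj j : injective (al ^~ j) by move=> i k /frob_inj /a_inj.
have [p [p0 sp rp]] := product_system_root al_inj a (fun=> 1).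
rewrite -ltnS; apply: leq_trans sp.
rewrite cardE; apply: max_poly_roots => //; last exact: enum_uniq.
apply/allP => x; rewrite mem_enum inE => /forallP xP.
apply: (rp x (fun j => x ^+ (q ^ j.+1))) => i.
have /eqP := xP i; rewrite /nrm addrC -prodrXr big_ord_recl expn0 => sys.
rewrite -[RHS]sys expr1; congr (_ * _); first by rewrite -(frobE 0%N) expn0.
by apply: eq_bigr => j _; rewrite frobE.
Qed.

End NormGraph.

(** * Counting common transversals *)

(** For [m > 2 * s] the ratio of the two binomials is [m / (m - s)], less than 2; smaller [m] are
    absorbed by the constant. This pays for the one element excluded in [directed_pair_sum]. *)
Lemma bin_leq_double_pred m s : ('C(m, s) <= 2 * 'C(m.-1, s) + 'C(2 * s, s))%N.
Proof.
case: (leqP m (2 * s)) => [ms|sm].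
  by rewrite (leq_trans (leq_bin2l _ ms)) // leq_addl.
apply: leq_trans (leq_addr _ _).
have m0 : (0 < m)%N by lia.
rewrite -(leq_pmul2l m0) mulnCA mul_bin_down mulnA leq_mul2r.
by apply/orP; right; lia.
Qed.

Lemma bin_leq_expn n k : ('C(n, k) <= n ^ k)%N.
Proof.
apply: (@leq_trans (n ^_ k)); first by rewrite -bin_ffact leq_pmulr // fact_gt0.
elim: k => [|k IH]; first by rewrite ffactn0 expn0.
by rewrite ffactnSr expnSr leq_mul // leq_subr.
Qed.

Section TransversalCount.
Variables (V C : finType) (col : V -> V -> C) (D : rel V) (R : V -> {set V}).
Variables (s t : nat).
Hypothesis D_total : forall u v, u != v -> D u v || D v u.
Hypothesis R_inj : forall u, {in R u &, injective (col u)}.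
Hypothesis few_extensions : forall (S : {set V}) v, #|S| = s ->
  (#|[set u | [&& u != v, S \subset R u, D u v &
       [forall x in S, col u x != col u v]]]| <= t)%N.

Lemma sum_draws (B : {set V}) :
  (\sum_(S : {set V} | #|S| == s) (S \subset B : nat) = 'C(#|B|, s))%N.
Proof.
rewrite -cards_draws -sum1_card big_mkcond [RHS]big_mkcond /=.
apply: eq_bigr => S _; rewrite finset.inE andbC.
by case: (_ == _); case: (_ \subset _).
Qed.

Let X := (\sum_(S : {set V} | #|S| == s) \sum_u (S \subset R u : nat))%N.

Lemma transversal_sum : X = (\sum_u 'C(#|R u|, s))%N.
Proof. by rewrite /X exchange_big; apply: eq_bigr => u _; rewrite sum_draws. Qed.

Let common u v : {set V} := R u :&: R v.

Lemma transversal_square_sum :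
  (\sum_(S : {set V} | #|S| == s) (\sum_u (S \subset R u : nat)) ^ 2 =
   \sum_u \sum_v 'C(#|common u v|, s))%N.
Proof.
transitivity (\sum_(S : {set V} | #|S| == s)
   \sum_u \sum_v (S \subset common u v : nat))%N.
  apply: eq_bigr => S _; rewrite -mulnn big_distrlr /=.
  apply: eq_bigr => u _; apply: eq_bigr => v _.
  by rewrite finset.subsetI mulnb.
rewrite exchange_big; apply: eq_bigr => u _.
by rewrite exchange_big; apply: eq_bigr => v _; rewrite sum_draws.
Qed.

(** By [R_inj] at most one element of [R u] has the colour of [uv]; [M u v] discards it. An [s]-set
    inside [M u v] makes [u] one of the at most [t] vertices of [few_extensions], and it also lies
    in [R v], so summing over such pairs of [S] and [v] gives [t * X]. *)
Lemma directed_pair_sum :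
  (\sum_u \sum_(v | (u != v) && D u v) 'C(#|common u v|.-1, s) <= t * X)%N.
Proof.
pose M u v := [set x in common u v | col u x != col u v].
have cM u v : (#|common u v|.-1 <= #|M u v|)%N.
  have sub : common u v \subset M u v :|: [set x in R u | col u x == col u v].
    apply/fintype.subsetP => x xc; rewrite finset.in_setU [x \in M u v]finset.inE.
    rewrite xc [X in _ || X]finset.inE; case: eqP => //= _.
    by move: xc; rewrite finset.inE => /andP[->].
  have c1 : (#|[set x in R u | col u x == col u v]| <= 1)%N.
    apply/card_le1_eqP => x y; rewrite !finset.inE.
    move=> /andP[xR /eqP xv] /andP[yR /eqP yv].
    by apply: (R_inj yR xR); rewrite yv xv.
  have := subset_leq_card sub; have := cardsU (M u v) [set x in R u | col u x == col u v].
  lia.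
apply: (@leq_trans (\sum_u \sum_(v | (u != v) && D u v)
    \sum_(S : {set V} | #|S| == s) (S \subset M u v : nat))%N).
  apply: leq_sum => u _; apply: leq_sum => v _.
  by rewrite sum_draws leq_bin2l.
rewrite (eq_bigr (fun u => \sum_(S : {set V} | #|S| == s)
   \sum_(v | (u != v) && D u v) (S \subset M u v : nat))%N); last first.
  by move=> u _; rewrite exchange_big.
rewrite exchange_big /X big_distrr /=; apply: leq_sum => S /eqP cS.
rewrite (eq_bigr (fun u => \sum_v
   (((u != v) && D u v) && (S \subset M u v) : nat))%N); last first.
  move=> u _; rewrite big_mkcond; apply: eq_bigr => v _.
  by case: (_ && _).
rewrite exchange_big big_distrr /=; apply: leq_sum => v _.
case: (boolP (S \subset R v)) => [Sv|Sv]; last first.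
  rewrite muln0 big1 // => u _; apply/eqP; rewrite eqb0 negb_and; apply/orP; right.
  apply: contra Sv => /fintype.subsetP H; apply/fintype.subsetP => x /H.
  by rewrite !finset.inE => /andP[/andP[]].
rewrite muln1; apply: leq_trans (few_extensions v cS).
rewrite -sum1_card big_mkcond [X in (_ <= X)%N]big_mkcond /=.
apply: leq_sum => u _; case: (boolP (_ && _)) => //= /andP[/andP[uv Duv]].
move=> /fintype.subsetP H; rewrite finset.inE uv Duv /=.
have -> : S \subset R u.
  by apply/fintype.subsetP => x /H; rewrite !finset.inE => /andP[/andP[]].
have -> // : [forall x in S, col u x != col u v].
by apply/forall_inP => x /H; rewrite !finset.inE => /andP[].
Qed.

(** A second moment argument: the square sum [Y] is bounded below by a multiple of [X] and above by
    a smaller multiple of [X], up to error terms. As [up] has [X] with coefficient [4 * t + 1],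
    taking [B] one larger leaves a single [X]. The assumption on [s] lets [n ^ s] absorb [n ^ 2]. *)
Lemma transversal_bound : (2 <= s)%N ->
  (\sum_u 'C(#|R u|, s) <=
   (2 * 'C(2 * s, s) + (4 * t + 2) ^ 2) * #|V| ^ s)%N.
Proof.
move=> s2; rewrite -transversal_sum.
set A := 'C(2 * s, s); set B := (4 * t + 2)%N; set n := #|V|.
set Y := (\sum_(S : {set V} | #|S| == s) (\sum_u (S \subset R u : nat)) ^ 2)%N.
(* For each [S] this is [B * x <= x ^ 2 + B ^ 2], clear on comparing [x] with [B]. *)
have low : (B * X <= Y + B ^ 2 * n ^ s)%N.
  have cn : (\sum_(S : {set V} | #|S| == s) 1 <= n ^ s)%N.
    rewrite sum1_card; apply: leq_trans (bin_leq_expn n s).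
    rewrite -card_draws; apply: eq_leq; apply: eq_card => S.
    by rewrite finset.inE.
  apply: leq_trans (_ : _ <= Y + B ^ 2 * (\sum_(S : {set V} | #|S| == s) 1))%N _; last first.
    by rewrite leq_add2l leq_mul2l cn orbT.
  rewrite /X /Y !big_distrr -big_split /=; apply: leq_sum => S _; nia.
(* The diagonal pairs contribute [X]; every other pair is directed by [D] in at least one way, hence
   the factor 2 in front of the directed sum. *)
have up : (Y <= X + 2 * (2 * (t * X) + A * n ^ 2))%N.
  rewrite /Y transversal_square_sum.
  set Z := (\sum_u \sum_(v | (u != v) && D u v) 'C(#|common u v|, s))%N.
  have ZE : Z = (\sum_u \sum_(v | (v != u) && D v u) 'C(#|common u v|, s))%N.
    rewrite /Z (exchange_big_dep xpredT) //=; apply: eq_bigr => v _.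
    by apply: eq_bigr => u _; rewrite /common finset.setIC.
  have YZ : (\sum_u \sum_v 'C(#|common u v|, s) <= X + 2 * Z)%N.
    rewrite transversal_sum mul2n -addnn {2}ZE /Z -!big_split /=.
    apply: leq_sum => u _; rewrite (bigD1 u) //= leq_add //.
      by rewrite /common finset.setIid.
    rewrite big_mkcond [X in (_ <= X + _)%N]big_mkcond [X in (_ <= _ + X)%N]big_mkcond.
    rewrite -big_split /=; apply: leq_sum => v _.
    rewrite [v == u]eq_sym; case: (boolP (u == v)) => //= uv.
    by move: (D_total uv); case: (D u v) => /= [_|->]; rewrite ?leq_addr ?leq_addl.
  have ZX : (Z <= 2 * (t * X) + A * n ^ 2)%N.
    apply: leq_trans (_ : _ <= 2 * (\sum_u \sum_(v | (u != v) && D u v)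
        'C(#|common u v|.-1, s)) + A * n ^ 2)%N _; last first.
      by rewrite leq_add2r leq_mul2l directed_pair_sum.
    apply: leq_trans (_ : _ <= \sum_(u : V) (2 * (\sum_(v | (u != v) && D u v)
        'C(#|common u v|.-1, s)) + A * n))%N _; last first.
      by rewrite big_split /= -big_distrr /= sum_nat_const -/n leq_add2l; lia.
    apply: leq_sum => u _.
    apply: leq_trans (_ : _ <= \sum_(v | (u != v) && D u v)
        (2 * 'C(#|common u v|.-1, s) + A))%N _.
      by apply: leq_sum => v _; exact: bin_leq_double_pred.
    rewrite big_split /= -big_distrr /= leq_add2l sum_nat_const mulnC leq_mul2l.
    by rewrite max_card orbT.
  by apply: leq_trans YZ _; rewrite leq_add2l leq_mul2l ZX.
have n2 : (n ^ 2 <= n ^ s)%N.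
  by case: (posnP n) => [->|n0]; [rewrite exp0n|rewrite leq_pexp2l].
have An : (A * n ^ 2 <= A * n ^ s)%N by rewrite leq_mul2l n2 orbT.
rewrite mulnDl -mulnA; move: low up An; rewrite /B.
set P := (_ * n ^ s)%N; set Q := (A * _ ^ s)%N; set Q' := (A * _)%N; nia.
Qed.

End TransversalCount.

(** * Rainbow bipartite graphs in star-colourings *)

Definition bipartite_adj (a b : nat) : rel ('I_a + 'I_b) := fun x y =>
  match x, y with inl _, inr _ | inr _, inl _ => true | _, _ => false end.

Lemma bipartite_adj_sym a b : symmetric (@bipartite_adj a b).
Proof. by move=> [i|i] [j|j]. Qed.

Lemma bipartite_adj_irrefl a b : irreflexive (@bipartite_adj a b).
Proof. by move=> [i|i]. Qed.

Definition complete_bipartite (a b : nat) : sgraph :=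
  SGraph (@bipartite_adj_sym a b) (@bipartite_adj_irrefl a b).

Lemma edgesP (G : sgraph) (e : {set G}) :
  reflect (exists x y, adj x y /\ e = [set x; y]) (e \in edges G).
Proof.
rewrite finset.inE; apply: (iffP existsP) => [[x /existsP[y /andP[xy /eqP ->]]]|].
  by exists x, y.
by move=> [x [y [xy ->]]]; exists x; apply/existsP; exists y; rewrite xy eqxx.
Qed.

Lemma adj_edge (G : sgraph) (x y : G) : adj x y -> [set x; y] \in edges G.
Proof. by move=> xy; apply/edgesP; exists x, y. Qed.

Lemma edges_bipartiteP a b (e : {set complete_bipartite a b}) :
  reflect (exists i j, e = [set inl i; inr j]) (e \in edges (complete_bipartite a b)).
Proof.
apply: (iffP (edgesP e)) => [[[i|i] [[j|j] [//= _ ->]]]|[i [j ->]]].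
- by exists i, j.
- by exists j, i; rewrite finset.setUC.
- by exists (inl i), (inr j).
Qed.

Section BipartiteRainbow.
Variables (G : sgraph) (C : finType) (c : {set G} -> C) (a b : nat).

Lemma rainbow_bipartite (A B : {set G}) :
  {in A & B, forall x y, adj x y} ->
  (forall x y x' y', x \in A -> y \in B -> x' \in A -> y' \in B ->
     c [set x; y] = c [set x'; y'] -> x = x' /\ y = y') ->
  (a <= #|A|)%N -> (b <= #|B|)%N -> has_rainbow c (complete_bipartite a b).
Proof.
move=> AB inj aA bB.
pose g (i : 'I_a) : G := enum_val (widen_ord aA i).
pose h (j : 'I_b) : G := enum_val (widen_ord bB j).
have gA i : g i \in A by exact: enum_valP.
have hB j : h j \in B by exact: enum_valP.
have ginj : injective g.
  by move=> i i' /enum_val_inj /(congr1 val) /= ii; exact: val_inj.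
have hinj : injective h.
  by move=> i i' /enum_val_inj /(congr1 val) /= ii; exact: val_inj.
have gh i j : adj (g i) (h j) by exact: AB.
have ghn i j : g i <> h j by move=> e; have := gh i j; rewrite e adj_irrefl.
pose f : {ffun complete_bipartite a b -> G} :=
  [ffun x => match x with inl i => g i | inr j => h j end].
have fe i j : f @: [set inl i; inr j] = [set g i; h j].
  by rewrite imsetU1 imset_set1 !ffunE.
apply/existsP; exists f; apply/andP; split.
  apply/andP; split.
    apply/injectiveP => [[i|i] [j|j]]; rewrite !ffunE.
    - by move=> /ginj ->.
    - by move=> /ghn.
    - by move=> /esym /ghn.
    - by move=> /hinj ->.
  apply/forallP => [[i|i]]; apply/forallP => [[j|j]]; apply/implyP => //= _;
    by rewrite !ffunE // adj_sym.
apply/forall_inP => _ /edges_bipartiteP[i [j ->]].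
apply/forall_inP => _ /edges_bipartiteP[i' [j' ->]].
rewrite !fe; apply/implyP => /eqP /inj [] // /ginj -> /hinj ->.
exact: eqxx.
Qed.

Lemma bipartite_rainbow : has_rainbow c (complete_bipartite a b) ->
  exists (g : 'I_a -> G) (h : 'I_b -> G),
    [/\ injective g, injective h, forall i j, adj (g i) (h j) &
      forall i j i' j', c [set g i; h j] = c [set g i'; h j'] -> i = i' /\ j = j'].
Proof.
move=> /existsP[f /andP[/andP[/injectiveP finj /forallP fadj] /forall_inP frb]].
exists (fun i => f (inl i)), (fun j => f (inr j)); split.
- by move=> i j /finj [].
- by move=> i j /finj [].
- by move=> i j; move/forallP: (fadj (inl i)) => /(_ (inr j)) /implyP; exact.
move=> i j i' j' cc.
have eE k l : [set inl k; inr l] \in edges (complete_bipartite a b).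
  by apply/edges_bipartiteP; exists k, l.
have /forall_inP/(_ _ (eE i' j'))/implyP := frb _ (eE i j).
rewrite !imsetU1 !imset_set1 cc eqxx => /(_ isT) /eqP ee.
have : (inl i : complete_bipartite a b) \in [set inl i'; inr j'].
  by rewrite -ee !finset.inE eqxx.
have : (inr j : complete_bipartite a b) \in [set inl i'; inr j'].
  by rewrite -ee !finset.inE eqxx orbT.
by rewrite !finset.inE => /orP[] // /eqP[->] /orP[] // /eqP[->].
Qed.

End BipartiteRainbow.

(* [D u v] says that the colour of [uv] is centred at [u] (a star with one edge
   being given one of its ends as centre), and [R u] consists of one leaf of each
   star centred at [u]. *)
Lemma star_colouring_centres (G : sgraph) (C : finType) (c : {set G} -> C) (v0 : G) :
  star_colouring c ->
  exists (D : rel G) (R : G -> {set G}),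
    [/\ forall u v, adj u v -> D u v || D v u,
        forall u x, x \in R u -> adj u x && D u x,
        forall u, {in R u &, injective (fun x => c [set u; x])},
        forall u x u' x', D u x -> D u' x' -> c [set u; x] = c [set u'; x'] -> u = u' &
        (\sum_u #|R u|)%N = #|colours c|].
Proof.
move=> /forall_inP sc.
(* The pair is a centre and a leaf of the star of colour [i]; [(v0, v0)] is a default for values
   that are not colours. *)
have centre i : exists p : G * G, i \in colours c ->
    [/\ adj p.1 p.2, c [set p.1; p.2] = i &
        forall e, e \in edges G -> c e = i -> p.1 \in e].
  case: (boolP (i \in colours c)) => [ic|]; last by exists (v0, v0).
  have /existsP[v /existsP[Lv /and3P[vL L0 /eqP cl]]] := sc i ic.
  have [x xL] := finset.set0Pn _ L0.
  have vx : [set v; x] \in colour_class c i by rewrite cl; apply/imsetP; exists x.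
  move: (vx); rewrite finset.inE => /andP[/edgesP[y [z [yz vxyz]]] /eqP cvx].
  exists (v, x) => _; split => //=.
    have yv : y \in [set v; x] by rewrite vxyz !finset.inE eqxx.
    have zv : z \in [set v; x] by rewrite vxyz !finset.inE eqxx orbT.
    move: yv zv yz; rewrite !finset.inE => /orP[] /eqP -> /orP[] /eqP -> //.
    - by rewrite adj_irrefl.
    - by rewrite adj_sym.
    - by rewrite adj_irrefl.
  move=> e eE ce; have : e \in colour_class c i by rewrite finset.inE eE ce /=.
  by rewrite cl => /imsetP[w _ ->]; rewrite !finset.inE eqxx.
have [p pP] := choice centre.
have edge_colour x y : adj x y -> c [set x; y] \in colours c.
  by move=> xy; apply: imset_f; exact: adj_edge.
pose fib u := [set i in colours c | (p i).1 == u].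
have leafK u i : i \in fib u -> c [set u; (p i).2] = i.
  by rewrite finset.inE => /andP[ic /eqP <-]; have [] := pP i ic.
exists (fun u v => (p (c [set u; v])).1 == u), (fun u => [set (p i).2 | i in fib u]).
split.
- move=> u v uv; have [_ _ H] := pP _ (edge_colour _ _ uv).
  have := H _ (adj_edge uv) erefl.
  by rewrite (finset.setUC [set v]) !finset.inE.
- move=> u _ /imsetP[i iu ->]; rewrite (leafK u i iu).
  move: iu; rewrite finset.inE => /andP[ic /eqP iu].
  by have [+ _ _] := pP i ic; rewrite iu eqxx andbT.
- by move=> u _ _ /imsetP[i iu ->] /imsetP[j ju ->]; rewrite !leafK // => ->.
- move=> u x u' x' /eqP uE /eqP uE' cc.
  by rewrite -[LHS]uE -[RHS]uE' cc.
rewrite -[RHS]sum1_card (partition_big (fun i => (p i).1) xpredT) //=.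
apply: eq_bigr => u _; rewrite card_in_imset.
  by rewrite -sum1_card; apply: eq_bigl => i; rewrite finset.inE.
by move=> i j iu ju ij; rewrite -(leafK u i iu) ij leafK.
Qed.

(** Here [d u] counts the stars centred at [u]. More than [t] vertices in [W] would give a rainbow
    copy on [v |: S] and [W]: all its edges are centred in [W], so equal colours share their end [u]
    in [W], and at [u] the colours towards [v |: S] are distinct. *)
Lemma star_colouring_no_rainbow_bipartite (n s t : nat) (C : finType)
    (c : {set complete_graph n} -> C) : (2 <= s)%N ->
  star_colouring c -> ~~ has_rainbow c (complete_bipartite s.+1 t.+1) ->
  exists2 d : 'I_n -> nat, #|colours c| = (\sum_u d u)%N &
    (\sum_u 'C(d u, s) <= (2 * 'C(2 * s, s) + (4 * t + 2) ^ 2) * n ^ s)%N.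
Proof.
case: n c => [|n] c s2 sc rc.
  exists (fun=> 0%N); last by rewrite big_ord0.
  rewrite big_ord0; apply: eq_card0 => i.
  by apply/imsetP => -[e /edgesP[[]]].
have [D [R [Dtot RD Rinj Dinj sumR]]] := star_colouring_centres (ord0 : complete_graph n.+1) sc.
exists (fun u => #|R u|); first by rewrite sumR.
rewrite -[X in (_ <= _ * X ^ _)%N]card_ord.
apply: (@transversal_bound _ _ (fun u v => c [set u; v]) D) => //.
move=> S v cS; rewrite leqNgt; apply: contra rc => tW.
set W := [set u | _] in tW.
have WP u : u \in W -> [/\ u != v, S \subset R u, D u v &
    forall x, x \in S -> c [set u; x] != c [set u; v]].
  by rewrite finset.inE => /and4P[? ? ? /forall_inP].
(* Otherwise the colour of [uv] would have to differ from itself. *)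
have vS : v \notin S.
  apply/negP => vS; have /card_gt0P[u /WP[_ _ _ /(_ v vS)]] : (0 < #|W|)%N by exact: leq_ltn_trans tW.
  by rewrite eqxx.
have uD u x : u \in W -> x \in v |: S -> adj u x && D u x.
  move=> /WP[uv /fintype.subsetP SR uvD _]; rewrite !finset.inE => /orP[/eqP ->|/SR /RD //].
  by rewrite uvD andbT.
apply: (@rainbow_bipartite _ _ c _ _ (v |: S) W) => //.
- by move=> x u xS uW; rewrite adj_sym; case/andP: (uD u x uW xS).
- move=> x u x' u' xS uW x'S u'W; rewrite (finset.setUC [set x]) (finset.setUC [set x']).
  move=> cc; have [_ ux] := andP (uD u x uW xS); have [_ ux'] := andP (uD u' x' u'W x'S).
  have uu := Dinj _ _ _ _ ux ux' cc; subst u'; split => //.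
  have [_ /fintype.subsetP SR _ good] := WP u uW.
  move: xS x'S; rewrite !finset.inE => /orP[/eqP xv|xS] /orP[/eqP x'v|x'S].
  + by rewrite xv x'v.
  + by have := good _ x'S; rewrite -cc xv eqxx.
  + by have := good _ xS; rewrite cc x'v eqxx.
  + exact: (Rinj u _ _ (SR _ xS) (SR _ x'S) cc).
- by rewrite cardsU1 vS cS.
Qed.

(** * Colouring by a graph and by minima *)

Lemma complete_edgeP n (e : {set complete_graph n}) :
  reflect (exists x y : 'I_n, (x < y)%N /\ e = [set x; y]) (e \in edges (complete_graph n)).
Proof.
apply: (iffP (edgesP e)) => [[x [y [xy ->]]]|[x [y [xy ->]]]]; last first.
  by exists x, y; split=> //; rewrite /= /complete_adj neq_ltn xy.
have : (x : 'I_n) != y by [].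
by rewrite neq_ltn => /orP[] ?; [exists x, y|exists y, x; rewrite finset.setUC].
Qed.

Section MinColouring.
Variables (n : nat) (F : rel 'I_n).
Hypotheses (F_sym : symmetric F) (F_irrefl : irreflexive F).

Definition rel_edge (e : {set 'I_n}) : bool :=
  [exists x, exists y, F x y && (e == [set x; y])].

(** The smaller end is encoded as a singleton, so the colours are again vertex sets and never clash
    with the two-element private colours. *)
Definition min_colouring (e : {set complete_graph n}) : {set 'I_n} :=
  if rel_edge e then e else [set x in e | [forall y in e, (x <= y)%N]].

Lemma rel_edge_pair x y : rel_edge [set x; y] = F x y.
Proof.
apply/existsP/idP => [[u /existsP[v /andP[uv /eqP E]]]|xy]; last first.
  by exists x; apply/existsP; exists y; rewrite xy eqxx.
have : u \in [set x; y] by rewrite E !finset.inE eqxx.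
have : v \in [set x; y] by rewrite E !finset.inE eqxx orbT.
rewrite !finset.inE => /orP[] /eqP vE /orP[] /eqP uE; subst u v => //.
- by rewrite F_irrefl in uv.
- by rewrite F_sym.
- by rewrite F_irrefl in uv.
Qed.

Lemma min_colouring_pair (x y : 'I_n) : (x < y)%N ->
  min_colouring [set x; y] = if F x y then [set x; y] else [set x].
Proof.
move=> xy; rewrite /min_colouring rel_edge_pair; case: ifP => // _.
apply/finset.setP => z; rewrite !finset.inE; apply/idP/idP.
  case/andP=> /orP[] // /eqP -> /forall_inP /(_ x).
  by rewrite !finset.inE eqxx leqNgt xy => /(_ isT).
move=> /eqP ->; rewrite eqxx /=; apply/forall_inP => w.
by rewrite !finset.inE => /orP[] /eqP -> //; exact: ltnW.
Qed.

Lemma min_colouring_star : star_colouring min_colouring.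
Proof.
apply/forall_inP => _ /imsetP[_ /complete_edgeP[x [y [xy ->]]] ->].
rewrite min_colouring_pair //; case: ifP => Fxy.
  apply/existsP; exists x; apply/existsP; exists [set y]; apply/and3P; split.
  - by rewrite finset.inE neq_ltn xy.
  - by apply/finset.set0Pn; exists y; rewrite finset.inE.
  apply/eqP/finset.setP => e; rewrite imset_set1 [RHS]finset.inE [LHS]finset.inE.
  apply/andP/eqP => [[/complete_edgeP[u [v [uv ->]]]]|->]; last first.
    by rewrite min_colouring_pair // Fxy eqxx; split=> //; apply/complete_edgeP; exists x, y.
  rewrite min_colouring_pair //; case: ifP => _ /eqP // E.
  have := congr1 (fun A : {set 'I_n} => #|A|) E.
  by rewrite /= cards1 cards2 neq_ltn xy.
apply/existsP; exists x; apply/existsP; exists [set z : 'I_n | (x < z)%N && ~~ F x z].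
apply/and3P; split.
- by rewrite finset.inE ltnn.
- by apply/finset.set0Pn; exists y; rewrite finset.inE xy Fxy.
apply/eqP/finset.setP => e; rewrite [LHS]finset.inE.
apply/andP/imsetP => [[/complete_edgeP[u [v [uv ->]]]]|[z]]; last first.
  rewrite finset.inE => /andP[xz Fxz] ->.
  rewrite min_colouring_pair // (negbTE Fxz) eqxx; split=> //.
  by apply/complete_edgeP; exists x, z.
rewrite min_colouring_pair //; case: ifP => Fuv /eqP E.
  have := congr1 (fun A : {set 'I_n} => #|A|) E.
  by rewrite /= cards1 cards2 neq_ltn uv.
move/set1_inj: E => ux; subst u.
by exists v; rewrite // finset.inE uv Fuv.
Qed.

(** Each edge of [F] is its own colour [e], and an ordered pair with underlying set [e] lies in [e]
    times [e], which has at most 4 elements. *)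
Lemma min_colouring_rel_colours :
  (\sum_x #|[set y | F x y]| <= 4 * #|colours min_colouring|)%N.
Proof.
pose P := [set p : 'I_n * 'I_n | F p.1 p.2].
have -> : (\sum_x #|[set y | F x y]|)%N = #|P|.
  rewrite -sum1_card (eq_bigr (fun x => \sum_(y | F x y) 1)%N); last first.
    by move=> x _; rewrite -sum1_card; apply: eq_bigl => y; rewrite finset.inE.
  by rewrite pair_big_dep /=; apply: eq_bigl => p; rewrite finset.inE.
pose pr (p : 'I_n * 'I_n) : {set 'I_n} := [set p.1; p.2].
rewrite -sum1_card (partition_big pr (mem (colours min_colouring))) /=.
  rewrite mulnC -sum_nat_const; apply: leq_sum => e _; rewrite sum1_card.
  case: (boolP (#|e| <= 2)%N) => [e2|e2]; last first.
    rewrite eq_card0 // => p; apply/andP => -[_ /eqP pe]; case/negP: e2.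
    by rewrite -pe cards2; case: (_ == _).
  apply: (@leq_trans #|finset.setX e e|); last by rewrite cardsX (leq_mul e2 e2).
  apply/subset_leq_card/fintype.subsetP => -[u v] /andP[_ /eqP <-].
  by rewrite finset.in_setX !finset.inE !eqxx orbT.
move=> [x y]; rewrite finset.inE /= => Fxy; rewrite /pr /=.
have -> : [set x; y] = min_colouring [set x; y].
  by rewrite /min_colouring rel_edge_pair Fxy.
apply: imset_f; apply: (@adj_edge (complete_graph n)).
by apply: contraTneq Fxy => ->; rewrite F_irrefl.
Qed.

(** Each [g i] is the colour of edges to at most one [h j] ([above]). If no [g i] serves as a colour
    at [h j], all non-edges of [F] there have colour [h j], so there is at most one and [h j] is
    joined in [F] to all [g k] but perhaps one ([full]). Each [i] is thus charged at most [1 + N]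
    times. *)
Lemma min_colouring_no_rainbow (s N t : nat) :
  (forall a : 'I_s -> 'I_n, injective a ->
     (#|[set x | [forall i, F (a i) x]]| <= N)%N) ->
  (s.+1 * N.+1 < t)%N -> ~~ has_rainbow min_colouring (complete_bipartite s.+1 t).
Proof.
move=> codeg tN; apply/negP => /bipartite_rainbow[g [h [ginj hinj gh cinj]]].
pose above (i : 'I_s.+1) j := ~~ F (g i) (h j) && (g i < h j)%N.
pose full (i : 'I_s.+1) j := [forall k : 'I_s, F (g (lift i k)) (h j)].
have aboveE i j : above i j -> min_colouring [set g i; h j] = [set g i].
  by case/andP => nF lt; rewrite min_colouring_pair // (negbTE nF).
have belowE i j : ~~ F (g i) (h j) -> ~~ above i j ->
    min_colouring [set g i; h j] = [set h j].
  move=> nF; rewrite /above nF /= -leqNgt => le.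
  have lt : (h j < g i)%N.
    by rewrite ltn_neqAle le andbT eq_sym; exact: gh.
  by rewrite finset.setUC min_colouring_pair // F_sym (negbTE nF).
have cover j : (1 <= \sum_i ((above i j : nat) + (full i j : nat)))%N.
  case: (boolP [exists i, above i j]) => [/existsP[i ij]|].
    by rewrite (bigD1 i) //= ij.
  rewrite negb_exists => /forallP na.
  have [i fi] : exists i, full i j.
    case: (boolP [exists i, ~~ F (g i) (h j)]) => [/existsP[i ij]|].
      exists i; apply/forallP => k; apply: contraT => kj.
      have [] // : i = lift i k /\ j = j.
        by apply: cinj; rewrite !belowE.
      by move/eqP; rewrite (negbTE (neq_lift i k)).
    rewrite negb_exists => /forallP all; exists ord0; apply/forallP => k.
    by have := all (lift ord0 k); rewrite negbK.
  by rewrite (bigD1 i) //= fi addn1.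
have : (\sum_(j < t) 1 <= \sum_(j < t) \sum_i ((above i j : nat) + (full i j : nat)))%N.
  by apply: leq_sum => j _; exact: cover.
rewrite sum1_card card_ord leqNgt => /negP; apply.
apply: leq_ltn_trans tN; rewrite exchange_big /=.
rewrite -[X in (_ <= X * _)%N]card_ord -sum_nat_const; apply: leq_sum => i _.
rewrite big_split /= -[N.+1]add1n leq_add //.
  have -> : (\sum_j (above i j : nat) = #|[set j | above i j]|)%N.
    rewrite -sum1_card [RHS]big_mkcond; apply: eq_bigr => j _.
    by rewrite finset.inE; case: (above i j).
  apply/card_le1_eqP => j k; rewrite !finset.inE => ij ik.
  by have [] : i = i /\ k = j by apply: cinj; rewrite !aboveE.
have liftinj : injective (g \o lift i) by apply: inj_comp => //; exact: lift_inj.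
apply: leq_trans (codeg _ liftinj).
have -> : (\sum_j (full i j : nat) = #|h @: [set j | full i j]|)%N.
  rewrite card_imset // -sum1_card [RHS]big_mkcond; apply: eq_bigr => j _.
  by rewrite finset.inE; case: (full i j).
apply/subset_leq_card/fintype.subsetP => _ /imsetP[j jf ->].
by move: jf; rewrite !finset.inE.
Qed.

End MinColouring.

(** The norm graph on the field with [q ^ m.+1] elements is copied onto the first vertices of
    ['I_n], the others being isolated; each field element has degree at least [q ^ m]. *)
Lemma norm_graph_embedding (m k n : nat) (q := (2 ^ k)%N) :
  (0 < k)%N -> (q ^ m.+1 <= n)%N ->
  exists F : rel 'I_n, [/\ symmetric F, irreflexive F,
    (q ^ (m.+1 + m) <= \sum_x #|[set y | F x y]|)%N &
    forall a : 'I_m.+1 -> 'I_n, injective a ->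
      (#|[set x | [forall i, F (a i) x]]| <= m.+1 ^ m)%N].
Proof.
move=> k0 qn; have q0 : (0 < q)%N by rewrite expn_gt0.
have km : (0 < k * m.+1)%N by rewrite muln_gt0 k0.
have [L ch2 cL0] := @pPrimePowerField 2 (k * m.+1) isT km.
have cL : #|L| = (q ^ m.+1)%N by rewrite cL0 expnM.
have q2 : (2%N : nat_pred).-nat q by rewrite pnatX.
have Ln : (#|L| <= n)%N by rewrite cL.
pose emb (u : L) : 'I_n := widen_ord Ln (enum_rank u).
have emb_inj : injective emb.
  move=> u v /(congr1 val) /= uv; apply: enum_rank_inj; exact: val_inj.
pose F : rel 'I_n := fun x y =>
  [exists u, exists v, [&& norm_adj q m u v, x == emb u & y == emb v]].
have FP x y : reflect (exists u v, [/\ norm_adj q m u v, x = emb u & y = emb v]) (F x y).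
  apply: (iffP existsP) => [[u /existsP[v /and3P[uv /eqP -> /eqP ->]]]|[u [v [uv -> ->]]]].
    by exists u, v.
  by exists u; apply/existsP; exists v; rewrite uv !eqxx.
have FE u v : F (emb u) (emb v) = norm_adj q m u v.
  apply/FP/idP => [[u' [v' [uv /emb_inj -> /emb_inj ->]]]|uv] //.
  by exists u, v.
exists F; split.
- move=> x y; apply/FP/FP => -[u [v [uv -> ->]]]; exists v, u;
  by rewrite norm_adj_sym.
- by move=> x; apply/FP => -[u [v [uv -> /emb_inj uv']]]; move: uv; rewrite uv' norm_adj_irrefl.
- rewrite expnD -cL -sum_nat_const.
  apply: (@leq_trans (\sum_(x in emb @: [set: L]) #|[set y | F x y]|)); last first.
    by rewrite [X in (_ <= X)%N](bigID (mem (emb @: [set: L]))) /= leq_addr.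
  rewrite big_imset /=; last by move=> u v _ _ /emb_inj.
  rewrite [X in (_ <= X)%N](eq_bigl (mem L)) => [|u]; last by rewrite finset.inE.
  apply: leq_sum => u _; apply: leq_trans (norm_degree q0 cL u) _.
  rewrite -(card_imset _ emb_inj); apply/subset_leq_card/fintype.subsetP.
  by move=> _ /imsetP[v uv ->]; move: uv; rewrite !finset.inE FE.
move=> a ainj; set W := [set x | _].
(* A single common neighbour already shows that every [a i] comes from the field. *)
case: (finset.set_0Vmem W) => [->|[x0]]; first by rewrite cards0.
rewrite finset.inE => /forallP ax0.
have pre i : exists u, a i == emb u.
  by case/FP: (ax0 i) => u [v [_ -> _]]; exists u.
pose a' i := xchoose (pre i).
have a'E i : a i = emb (a' i) by exact/eqP/(xchooseP (pre i)).
have a'inj : injective a' by move=> i j ij; apply: ainj; rewrite !a'E ij.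
apply: leq_trans (norm_codegree ch2 q2 a'inj); rewrite -(card_imset _ emb_inj).
apply/subset_leq_card/fintype.subsetP => x; rewrite finset.inE => /forallP xP.
have [_ [v [_ _ xv]]] := FP _ _ (xP ord0).
rewrite xv; apply/imsetP; exists v => //; rewrite finset.inE; apply/forallP => i.
by rewrite -FE -a'E -xv; exact: xP.
Qed.

Lemma ar_star_bipartite_lower (m k n t : nat) (q := (2 ^ k)%N) :
  (0 < k)%N -> (q ^ m.+1 <= n)%N -> (m.+2 * (m.+1 ^ m).+1 < t)%N ->
  (q ^ (m.+1 + m) <= 4 * ar_star n (complete_bipartite m.+2 t))%N.
Proof.
move=> k0 qn tN; have [F [Fs Fi Fd Fc]] := norm_graph_embedding k0 qn.
apply: leq_trans Fd _; apply: leq_trans (min_colouring_rel_colours Fs Fi) _.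
rewrite leq_mul2l /=; apply: leq_ar_star; first exact: min_colouring_star.
exact: (min_colouring_no_rainbow Fs Fi Fc tN).
Qed.

(** * Triangles *)

Lemma rainbow_triangle (G : sgraph) (C : finType) (c : {set G} -> C) (u x y : G) :
  adj u x -> adj u y -> adj x y ->
  c [set u; x] != c [set u; y] -> c [set x; y] != c [set u; x] ->
  c [set x; y] != c [set u; y] -> has_rainbow c (complete_graph 3).
Proof.
move=> ux uy xy c1 c2 c3.
have n1 (v w : G) : adj v w -> v != w.
  by apply: contraTneq => ->; rewrite adj_irrefl.
pose f : {ffun complete_graph 3 -> G} := [ffun i : 'I_3 => tnth [tuple u; x; y] i].
have f0 (H : (0 < 3)%N) : f (Ordinal H) = u by rewrite ffunE.
have f1 (H : (1 < 3)%N) : f (Ordinal H) = x by rewrite ffunE.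
have f2 (H : (2 < 3)%N) : f (Ordinal H) = y by rewrite ffunE.
have nux := n1 _ _ ux; have nuy := n1 _ _ uy; have nxy := n1 _ _ xy.
apply/existsP; exists f; apply/andP; split.
  apply/andP; split.
    apply/injectiveP => -[[|[|[|i]]] Hi] [[|[|[|j]]] Hj] //; rewrite ?(f0, f1, f2) => E;
      try (by apply: val_inj); by move: nux nuy nxy; rewrite E eqxx.
  apply/forallP => -[[|[|[|i]]] Hi]; apply/forallP => -[[|[|[|j]]] Hj] //;
    by apply/implyP; rewrite ?(f0, f1, f2) // => _; rewrite // adj_sym.
apply/forall_inP => _ /complete_edgeP[[[|[|[|i]]] Hi] [[[|[|[|j]]] Hj] [//= _ ->]]];
  apply/forall_inP => _ /complete_edgeP[[[|[|[|i']]] Hi'] [[[|[|[|j']]] Hj'] [//= _ ->]]];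
  rewrite !imsetU1 !imset_set1 ?(f0, f1, f2); apply/implyP => E;
  try (by apply/eqP; congr [set _; _]; apply: val_inj);
  by move: c1 c2 c3; rewrite ?(eqP E) ?eqxx // (eq_sym (c _)) E.
Qed.

(** Every vertex centres at most one star: if [x] and [y] are leaves of two stars at [u], the colour
    of [xy] is centred at [x] or [y], hence differs from those of [ux] and [uy]. *)
Lemma ar_star_triangle_upper n : (ar_star n (complete_graph 3) <= n)%N.
Proof.
apply/bigmax_leqP => c /andP[sc rc].
case: n c sc rc => [|n] c sc rc.
  rewrite leqn0 cards_eq0 -finset.subset0; apply/fintype.subsetP => i.
  by move=> /imsetP[e /edgesP[[]]].
have [D [R [Dtot RD Rinj Dinj <-]]] := star_colouring_centres (ord0 : complete_graph n.+1) sc.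
rewrite -[X in (_ <= X)%N]card_ord -sum1_card; apply: leq_sum => u _.
apply: contraNT rc; rewrite -ltnNge => /card_gt1P[x [y [xR yR xy]]].
have /andP[ux Dux] := RD _ _ xR; have /andP[uy Duy] := RD _ _ yR.
have axy : adj (x : complete_graph n.+1) y by [].
have centre_neq v w z : D v w -> D u z -> u != v -> c [set v; w] != c [set u; z].
  by move=> vw uz; apply: contra => /eqP E; apply/eqP/esym/(Dinj _ _ _ _ vw uz).
have xy_neq z : D u z -> c [set x; y] != c [set u; z].
  move=> uz; case/orP: (Dtot _ _ axy) => Dxy; last rewrite finset.setUC;
    exact: centre_neq.
apply: (rainbow_triangle ux uy axy); [|exact: xy_neq|exact: xy_neq].
by apply: contra xy => /eqP E; apply/eqP; exact: (Rinj u).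
Qed.

(** With [F] empty, each vertex but the last is a colour, and the two edges of a triangle at its
    smallest vertex agree. *)
Lemma ar_star_triangle_lower n : (n.-1 <= ar_star n (complete_graph 3))%N.
Proof.
case: n => [//|n] /=.
pose F : rel 'I_n.+1 := fun _ _ => false.
have Fs : symmetric F by [].
have Fi : irreflexive F by [].
have pairE (x y : 'I_n.+1) : (x < y)%N -> min_colouring F [set x; y] = [set x].
  by move=> xy; rewrite min_colouring_pair.
have sc := min_colouring_star Fs Fi.
apply: leq_trans (leq_ar_star sc _).
  rewrite -[X in (X <= _)%N]card_ord.
  have inj : injective (fun i : 'I_n => [set widen_ord (leqnSn n) i]).
    by move=> i j /set1_inj /(congr1 val) /= ij; exact: val_inj.
  rewrite -(card_imset _ inj); apply/subset_leq_card/fintype.subsetP.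
  move=> _ /imsetP[i _ ->].
  have lt : (widen_ord (leqnSn n) i < @ord_max n)%N by rewrite /= ltn_ord.
  rewrite -(pairE _ _ lt).
  by apply: imset_f; apply/complete_edgeP; exists (widen_ord (leqnSn n) i), ord_max.
apply/negP => /existsP[f /andP[/andP[/injectiveP finj _] /forall_inP frb]].
pose i : 'I_3 := [arg min_(i < ord0) (f i : 'I_n.+1)].
have fi (l : 'I_3) : l != i -> (f i < f l)%N.
  move=> li; rewrite ltn_neqAle; apply/andP; split.
    by apply: contra li => /eqP /val_inj /finj ->.
  by rewrite /i; case: arg_minnP => // k _; apply.
have eE (k : 'I_2) : [set i; lift i k] \in edges (complete_graph 3).
  by apply: (@adj_edge (complete_graph 3)); exact: neq_lift.
have /forall_inP/(_ _ (eE (inord 1)))/implyP := frb _ (eE ord0).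
rewrite !imsetU1 !imset_set1 !pairE ?fi ?neq_lift 1?eq_sym ?neq_lift //.
rewrite eqxx => /(_ isT) /eqP/finset.setP/(_ (lift i ord0)).
rewrite !finset.inE eqxx orbT [lift i ord0 == i]eq_sym (negbTE (neq_lift _ _)) /=.
by move=> /eqP/lift_inj/(congr1 val); rewrite /= inordK.
Qed.

(** * Real estimates *)

Lemma expn_leq_ffact d k : ((d - k) ^ k <= d ^_ k)%N.
Proof.
elim: k => [|k IH]; first by rewrite ffactn0.
rewrite ffactnSr expnSr leq_mul ?leq_sub2l //.
by apply: leq_trans IH; case: k => // k; rewrite leq_exp2r // leq_sub2l.
Qed.

Section RealBounds.
Variable R : realType.

(** Above the threshold [lam], multiplying [x] by [(x / lam) ^+ s] only increases it. This takes the
    place of the power mean inequality. *)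
Lemma leq_add_powR (x lam : R) s : 0 <= x -> 0 < lam ->
  x <= lam + x ^+ s.+1 / lam ^+ s.
Proof.
move=> x0 lam0; case: (leP x lam) => [xl|/ltW lx].
  by rewrite (le_trans xl) // lerDl divr_ge0 // exprn_ge0 // ltW.
apply: (@le_trans _ _ (x ^+ s.+1 / lam ^+ s)); last by rewrite lerDr ltW.
rewrite ler_pdivlMr ?exprn_gt0 // exprS ler_wpM2l //.
by apply: lerXn2r => //; rewrite nnegrE // ltW.
Qed.

(** Up to an additive [m.+1], [d u] is at most [lam] plus a power of [d u - m.+1] that
    ['C(d u, m.+1)] controls through the falling factorial. *)
Lemma sum_bin_bound (n m K : nat) (d : 'I_n -> nat) : (0 < n)%N ->
  (\sum_u 'C(d u, m.+1) <= K * n ^ m.+1)%N ->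
  ((\sum_u d u)%N)%:R <=
    (1 + (m.+1`! * K)%:R + m.+1%:R) * n%:R `^ (2 - 1 / m.+1%:R) :> R.
Proof.
move=> n0 dK; set r := 2 - 1 / m.+1%:R.
pose x : R := n%:R; have x0 : 0 < x by rewrite ltr0n.
have x1 : 1 <= x by rewrite ler1n.
have s0 : m.+1%:R != 0 :> R by rewrite pnatr_eq0.
have sm : m.+1%:R = m%:R + 1 :> R by rewrite natr1.
(* This threshold balances the two main terms: [x * lam] and [x ^+ m.+1 / lam ^+ m] both equal [x]
   to the power [r]. *)
pose lam := x `^ (1 - 1 / m.+1%:R).
have lam0 : 0 < lam by rewrite powR_gt0.
have lamE : x * lam = x `^ r.
  rewrite -[X in X * _]powRr1 ?ltW // -powRD; last by rewrite (gt_eqF x0) implybT.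
  by congr (_ `^ _); rewrite /r; ring.
have lamE' : x ^+ m.+1 = x `^ r * lam ^+ m.
  rewrite -!powR_mulrn ?ltW // -powRrM -powRD; last by rewrite (gt_eqF x0) implybT.
  by congr (_ `^ _); rewrite /r sm; field; rewrite -sm.
have xr : x <= x `^ r.
  rewrite -{1}[x](powRr1 (ltW x0)) ler_powR // /r.
  have : 1 / m.+1%:R <= 1 :> R by rewrite ler_pdivrMr ?ltr0n // mul1r ler1n.
  move: (1 / m.+1%:R : R) => y; lra.
have dle u : (d u)%:R <= lam + ((d u - m.+1) ^ m.+1)%:R / lam ^+ m + m.+1%:R :> R.
  apply: (@le_trans _ _ ((d u - m.+1)%:R + m.+1%:R)).
    by rewrite -natrD ler_nat; lia.
  by rewrite lerD2r natrX leq_add_powR.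
have pw : (\sum_u (d u - m.+1) ^ m.+1 <= (m.+1`! * K) * n ^ m.+1)%N.
  rewrite -mulnA; apply: leq_trans (_ : _ <= m.+1`! * (\sum_u 'C(d u, m.+1)))%N _.
    rewrite big_distrr /=; apply: leq_sum => u _.
    by rewrite mulnC bin_ffact expn_leq_ffact.
  by rewrite leq_mul2l dK orbT.
rewrite natr_sum; apply: le_trans (ler_sum _ (fun u _ => dle u)) _.
rewrite !big_split /= !sumr_const card_ord -mulr_suml -natr_sum.
rewrite -[lam *+ n]mulr_natl -[m.+1%:R *+ n]mulr_natl -/x lamE mulrDl mulrDl mul1r.
apply: lerD; last by rewrite mulrC ler_wpM2l.
apply: lerD => //.
rewrite ler_pdivrMr ?exprn_gt0 // -mulrA -lamE' -natrX -natrM ler_nat.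
exact: pw.
Qed.

Lemma ar_star_leP (n : nat) (H : sgraph) (x : R) : 0 <= x ->
  (forall c : {ffun {set complete_graph n} -> {set complete_graph n}},
     star_colouring c -> ~~ has_rainbow c H -> #|colours c|%:R <= x) ->
  (ar_star n H)%:R <= x.
Proof.
move=> x0 cx; rewrite /ar_star; elim/big_ind: _ => // [a b ax bx|c /andP[]].
  by rewrite /maxn; case: ifP.
exact: cx.
Qed.

(** The exponent times [m.+1] is the integer [m.+1 + m], so the real power of the upper bound on [n]
    is an ordinary power of [2 * q]. *)
Lemma powR_leq_expn (m n q : nat) : (n <= (2 * q) ^ m.+1)%N ->
  n%:R `^ (2 - 1 / m.+1%:R) <= 2 ^+ (m.+1 + m) * (q ^ (m.+1 + m))%:R :> R.
Proof.
move=> nq; set r := 2 - 1 / m.+1%:R.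
have r0 : 0 <= r.
  have : 1 / m.+1%:R <= 1 :> R by rewrite ler_pdivrMr ?ltr0n // mul1r ler1n.
  rewrite /r; move: (1 / m.+1%:R : R) => y; lra.
apply: (@le_trans _ _ (((2 * q) ^ m.+1)%:R `^ r)).
  by apply: ge0_ler_powR; rewrite ?nnegrE ?ler0n ?ler_nat.
rewrite natrX -powR_mulrn // -powRrM.
have -> : m.+1%:R * r = (m.+1 + m)%:R.
  have sm : m.+1%:R = m%:R + 1 :> R by rewrite natr1.
  have s0 : m.+1%:R != 0 :> R by rewrite pnatr_eq0.
  by rewrite /r natrD sm; field; rewrite -sm.
by rewrite powR_mulrn // natrM exprMn natrX.
Qed.

Lemma bigTheta_ge0 (f g : nat -> R) (c C : R) (N : nat) : 0 < c -> 0 < C ->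
  (forall n, 0 <= f n) -> (forall n, 0 <= g n) ->
  (forall n, (N <= n)%N -> c * g n <= f n /\ f n <= C * g n) ->
  f \is 'Theta_(\oo%classic) g.
Proof.
move=> c0 C0 f0 g0 fg; apply/asboolP; exists (c, C); first by rewrite /= c0.
by exists N => // n /= /fg; rewrite !ger0_norm.
Qed.

End RealBounds.

Theorem corollary1p10 (R : realType) (s : nat) (hs : (1 <= s)%N) :
  star_realisable (2 - 1 / s%:R : R).
Proof.
have s0 : (0 : R) < s%:R by rewrite ltr0n.
have s1 : 1 / s%:R <= 1 :> R by rewrite ler_pdivrMr // mul1r ler1n.
have s2 : 0 <= 1 / s%:R :> R by rewrite divr_ge0 ?ltW.
split; first by apply/andP; split; move: (1 / s%:R : R) s1 s2 => y; lra.
case: s hs s0 s1 s2 => [//|[|m]] _ _ _ _.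
  exists (complete_graph 3).
  apply: (@bigTheta_ge0 _ _ _ 2^-1 1 2).
  - by rewrite invr_gt0 ltr0n.
  - exact: ltr01.
  - by move=> n; exact: ler0n.
  - by move=> n; exact: powR_ge0.
  move=> n n2; rewrite divr1 (_ : 2 - 1 = 1 :> R); last by ring.
  rewrite powRr1 ?ler0n // mul1r ler_nat ar_star_triangle_upper; split => //.
  rewrite ler_pdivrMl ?ltr0n // -natrM ler_nat.
  have := ar_star_triangle_lower n; lia.
(* Now [s = m.+2]: [N] bounds the codegrees of the norm graph over the field with [q ^ s] elements,
   and [t.+1] just exceeds the bound that [min_colouring_no_rainbow] requires. *)
pose N := (m.+2 ^ m.+1)%N; pose t := (m.+3 * N.+1)%N.
pose K := (2 * 'C(2 * m.+2, m.+2) + (4 * t + 2) ^ 2)%N.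
exists (complete_bipartite m.+3 t.+1).
(* In the lower constant, 4 comes from [min_colouring_rel_colours] and the power of 2 from rounding
   to a power of two; the threshold on [n] ensures that [k] is positive. *)
apply: (@bigTheta_ge0 _ _ _ (4 * 2 ^+ (m.+2 + m.+1))^-1
  (1 + (m.+2`! * K)%:R + m.+2%:R) (2 ^ m.+2)).
- by rewrite invr_gt0 mulr_gt0 ?exprn_gt0 ?ltr0n.
- by rewrite addr_gt0 ?ltr0n // ltr_wpDr.
- by move=> n; exact: ler0n.
- by move=> n; exact: powR_ge0.
move=> n nbig.
have n0 : (0 < n)%N by apply: leq_trans nbig; rewrite expn_gt0.
split; last first.
  apply: ar_star_leP => [|c sc rc].
    apply: mulr_ge0; last exact: powR_ge0.
    by apply: addr_ge0; [apply: addr_ge0; [exact: ler01|exact: ler0n]|exact: ler0n].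
  have [d -> dK] := star_colouring_no_rainbow_bipartite (isT : (2 <= m.+2)%N) sc rc.
  exact: sum_bin_bound.
(* The largest [k] with [(2 ^ k) ^ s <= n]. *)
pose k := trunc_log (2 ^ m.+2) n.
have b1 : (1 < 2 ^ m.+2)%N by rewrite -[1%N](expn0 2) ltn_exp2l.
have k0 : (0 < k)%N by rewrite trunc_log_gt0 b1 prednK ?expn_gt0.
have kn : ((2 ^ k) ^ m.+2 <= n)%N by rewrite -expnM mulnC expnM trunc_logP.
have nk : (n <= (2 * 2 ^ k) ^ m.+2)%N.
  by rewrite -expnS -expnM mulnC expnM ltnW // trunc_log_ltn.
set c : R := 2 ^+ (m.+2 + m.+1).
have c0 : 0 < c by rewrite exprn_gt0.
rewrite ler_pdivrMl; last by rewrite mulr_gt0 ?ltr0n.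
set y : R := (ar_star n _)%:R.
have -> : 4 * c * y = c * (4 * y) by ring.
apply: le_trans (powR_leq_expn R nk) _; rewrite (ler_pM2l c0) -natrM ler_nat.
exact: ar_star_bipartite_lower.
Qed.
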